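(* Let $\Omega=\sum_{|I|=|K|=p}\Omega_{IK}\,dx_I\wedge d\xi_K$ be a form of bidegree $(p,p)$ with constant real coefficients on $\mathbb R^n_x\oplus\mathbb R^n_\xi$ satisfying $T(\Omega)=0$. Then $\Omega$ can be written as a (finite, real) linear combination of elementary forms.
   Context: The operator $T$ is defined by $T(u)=\sum_{i=1}^n dx_i\wedge\delta_{\xi_i}(u)$, where $\delta_{\xi_i}$ is contraction with the vector field $\partial/\partial\xi_i$. For a form $\alpha=\sum_j\alpha_jdx_j$ of bidegree $(1,0)$ (with constant real coefficients), $\alpha^\#=\sum_j\alpha_jd\xi_j$. An elementary form of bidegree $(p,p)$ is a form that can be written $\alpha_1\wedge\alpha_1^\#\wedge\dots\wedge\alpha_p\wedge\alpha_p^\#$ with $\alpha_1,\dots,\alpha_p$ of bidegree $(1,0)$. *)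

(* Defs.v *)
From HB Require Import structures.
From mathcomp Require Import all_boot all_order all_algebra.
From mathcomp Require Import reals.

Set Implicit Arguments.
Unset Strict Implicit.
Unset Printing Implicit Defensive.

Import GRing.Theory.
Local Open Scope ring_scope.

(* The exterior algebra on m ordered generators e_0, ..., e_(m-1): an element is
   given by its coefficients on the monomials e_S (S a set of indices), where
   e_S is the product of the e_i, i \in S, in increasing order. *)
Definition ext (R : realType) (m : nat) := {ffun {set 'I_m} -> R^o}.

Definition blade {R : realType} {m : nat} (S : {set 'I_m}) : ext R m :=
  [ffun U => (U == S)%:R].

Definition ext1 {R : realType} {m : nat} : ext R m := blade set0.

Definition gen {R : realType} {m : nat} (i : 'I_m) : ext R m := blade [set i].

Definition inversions {m : nat} (A B : {set 'I_m}) : nat :=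
  (\sum_(a in A) \sum_(b in B) (b < a))%N.

(* e_A /\ e_B = (-1)^(inversions A B) e_(A u B) if A and B are disjoint,
   and 0 otherwise; extended bilinearly. *)
Definition wedge {R : realType} {m : nat} (u v : ext R m) : ext R m :=
  [ffun S : {set 'I_m} =>
     \sum_(A : {set 'I_m} | A \subset S)
        (-1) ^+ inversions A (S :\: A) * u A * v (S :\: A)].

(* Contraction with the vector dual to e_k:
   e_S |-> (-1)^#{j in S, j < k} e_(S \ k) if k \in S, and e_S |-> 0 if not. *)
Definition contract {R : realType} {m : nat} (k : 'I_m) (u : ext R m) :
    ext R m :=
  [ffun S : {set 'I_m} =>
     if k \in S then 0
     else (-1) ^+ (\sum_(j in S) (j < k))%N * u (k |: S)].

Section Laws.
Variables (R : realType) (m : nat).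
Implicit Types (u v w : ext R m) (A B C S : {set 'I_m}) (i j k : 'I_m).

Lemma inversions1 i B : inversions [set i] B = (\sum_(j in B) (j < i))%N.
Proof. by rewrite /inversions big_set1. Qed.

Lemma sum_setU A B (F : 'I_m -> nat) : [disjoint A & B] ->
  (\sum_(i in A :|: B) F i = \sum_(i in A) F i + \sum_(i in B) F i)%N.
Proof.
by move=> dAB; rewrite -bigU //; apply: eq_bigl => i; rewrite !inE.
Qed.

Lemma inversionsUl A B C : [disjoint A & B] ->
  inversions (A :|: B) C = (inversions A C + inversions B C)%N.
Proof. by move=> dAB; rewrite /inversions sum_setU. Qed.

Lemma inversionsUr A B C : [disjoint B & C] ->
  inversions A (B :|: C) = (inversions A B + inversions A C)%N.
Proof.
move=> dBC; rewrite /inversions -big_split.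
by apply: eq_bigr => a _; rewrite sum_setU.
Qed.

Lemma wedge1l u : wedge ext1 u = u.
Proof.
apply/ffunP=> S; rewrite ffunE (bigD1 set0) ?sub0set //= ffunE eqxx setD0.
rewrite /inversions big_set0 !mul1r big1 ?addr0 // => A /andP[_ /negbTE nA].
by rewrite ffunE nA mulr0 mul0r.
Qed.

Lemma wedge1r u : wedge u ext1 = u.
Proof.
apply/ffunP=> S; rewrite ffunE (bigD1 S) //= ffunE setDv eqxx.
rewrite /inversions big1 ?mul1r ?mulr1 => [|a _]; last by rewrite big_set0.
rewrite big1 ?addr0 // => A /andP[sAS nA].
rewrite ffunE setD_eq0; case: (boolP (S \subset A)) => [sSA|_].
  by rewrite eqEsubset sAS sSA in nA.
by rewrite mulr0.
Qed.

Lemma wedgeA u v w : wedge u (wedge v w) = wedge (wedge u v) w.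
Proof.
apply/ffunP=> S; rewrite !ffunE.
under eq_bigr => A _ do rewrite ffunE mulr_sumr.
under [RHS]eq_bigr => C _ do rewrite ffunE mulr_sumr mulr_suml.
rewrite [RHS](exchange_big_dep (fun A => A \subset S)) /=; last first.
  by move=> C A sCS sAC; apply: subset_trans sCS.
apply: eq_bigr => A sAS.
rewrite [RHS](reindex_onto (fun B => A :|: B) (fun C => C :\: A)) /=; last first.
  by move=> C /andP[_ sAC]; apply/setP=> x; rewrite !inE;
     case: (boolP (x \in A)) => //= /(subsetP sAC) ->.
apply: eq_big => [B|B sB].
  rewrite subsetD subUset sAS subsetUl andbT /=; congr (_ && _).
  rewrite setDUl setDv set0U; apply/idP/eqP => [/setDidPl //|<-].
  by rewrite -setI_eq0 setIDAC -setIDA setDv setI0.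
move: sB; rewrite subsetD => /andP[sBS dBA].
have dAB : [disjoint A & B] by rewrite disjoint_sym.
have -> : (A :|: B) :\: A = B by rewrite setDUl setDv set0U; apply/setDidPl.
have -> : S :\: (A :|: B) = S :\: A :\: B by rewrite setDDl.
set D := S :\: A :\: B.
have E : S :\: A = B :|: D.
  apply/setP=> x; rewrite !inE; case xB: (x \in B) => //=.
  by rewrite (subsetP sBS) ?xB // andbT (disjointFr dBA xB).
have dBD : [disjoint B & D].
  by rewrite -setI_eq0; apply/eqP/setP=> x; rewrite !inE; case: (x \in B).
rewrite E inversionsUl // inversionsUr // !exprD !mulrA.
by rewrite [LHS](ACl (2*4*1*3*5*6)).
Qed.

Lemma gen_wedgeE i u S :
  wedge (gen i) u S =
  if i \in S then (-1) ^+ (\sum_(j in S :\ i) (j < i))%N * u (S :\ i) else 0.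
Proof.
rewrite ffunE; case: ifPn => iS.
  rewrite (bigD1 [set i]) ?sub1set //= ffunE eqxx mulr1 inversions1.
  rewrite [X in _ + X]big1 ?addr0 // => A /andP[_ /negbTE nA].
  by rewrite ffunE nA mulr0 mul0r.
rewrite big1 // => A sAS; rewrite ffunE; case: eqP => [eA|_].
  by rewrite eA sub1set (negbTE iS) in sAS.
by rewrite mulr0 mul0r.
Qed.

Lemma contract1 k : contract k ext1 = 0 :> ext R m.
Proof.
apply/ffunP=> S; rewrite !ffunE; case: ifP => // _.
suff -> : (k |: S == set0) = false by rewrite mulr0.
by apply/eqP=> /setP/(_ k); rewrite !inE eqxx.
Qed.

Lemma contract_gen_wedge k i u :
  contract k (wedge (gen i) u) =
  (i == k)%:R *: u - wedge (gen i) (contract k u).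
Proof.
apply/ffunP=> S; rewrite ffunE gen_wedgeE [RHS]ffunE [in RHS]ffunE.
rewrite [X in _ + X]ffunE gen_wedgeE !ffunE !inE.
have [->|nik] := eqVneq i k; rewrite ?eqxx /=.
  rewrite scale1r; case: ifP => kS.
    rewrite mulrA -expr2 sqrr_sign mul1r setD1K // subrr //.
  by rewrite setU1K ?kS // mulrA -expr2 sqrr_sign mul1r subr0.
rewrite scale0r add0r.
case: (boolP (k \in S)) => kS; first by rewrite mulr0 if_same oppr0.
case: (boolP (i \in S)) => iS; last by rewrite mulr0 oppr0.
have -> : (k |: S) :\ i = k |: (S :\ i).
  by apply/setP=> x; rewrite !inE; case: eqP => //= ->; rewrite (negbTE nik).
rewrite big_setU1 ?inE ?(negbTE kS) ?andbF //= (big_setD1 i) //=.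
rewrite !mulrA -!exprD -mulNr; congr (_ * _).
have : ((i < k) + (k < i) = 1)%N.
  by move: nik; rewrite -val_eqE /=; case: ltngtP.
by move=> ik; rewrite -[RHS]mulN1r -exprS; congr (_ ^+ _);
   rewrite addnACA ik add1n addnC.
Qed.

Lemma gen_sq0 i : wedge (gen i) (gen i) = 0 :> ext R m.
Proof.
apply/ffunP=> S; rewrite gen_wedgeE !ffunE; case: ifP => // _.
suff -> : (S :\ i == [set i]) = false by rewrite mulr0.
by apply/eqP=> /setP/(_ i); rewrite !inE eqxx.
Qed.

Lemma gen_anticomm i j : wedge (gen i) (gen j) = - wedge (gen j) (gen i) :> ext R m.
Proof.
have [->|nij] := eqVneq i j; first by rewrite gen_sq0 oppr0.
have D (a b : 'I_m) (S : {set 'I_m}) : a != b ->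
    wedge (gen a) (gen b) S =
    if S == [set a; b] then (-1) ^+ (b < a)%N else 0 :> R.
  move=> nab; rewrite gen_wedgeE ffunE; case: ifPn => aS.
    rewrite -(setD1K aS) setU1K ?setD11 //.
    have -> : (a |: S :\ a == [set a; b]) = (S :\ a == [set b]).
      apply/eqP/eqP=> [E|-> //].
      by rewrite -[S :\ a](@setU1K _ a) ?setD11 // E setU1K // inE.
    by case: eqP => [->|_]; rewrite ?mulr0 // big_set1 mulr1.
  by case: eqP aS => // ->; rewrite !inE eqxx.
apply/ffunP=> S; rewrite [RHS]ffunE !D 1?[j == i]eq_sym // [[set j; i]]setUC.
case: eqP => _; last by rewrite oppr0.
by move: nij; rewrite -val_eqE /=; case: ltngtP => // _ _;
   rewrite ?expr0 ?expr1 ?opprK.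
Qed.

Lemma prod_gen S : \big[wedge/ext1]_(i <- enum S) gen i = blade S :> ext R m.
Proof.
have: sorted ltn [seq val i | i <- enum S].
  apply: (subseq_sorted ltn_trans _ (iota_ltn_sorted 0 m)).
  by rewrite -val_enum_ord map_subseq // enumT filter_subseq.
have -> : blade S = blade [set:: enum S] :> ext R m.
  by congr blade; apply/setP=> x; rewrite inE mem_enum.
elim: (enum S) => [_|i s IHs /= pis].
  by rewrite big_nil; congr blade; apply/setP=> x; rewrite !inE.
rewrite big_cons IHs ?(path_sorted pis) //.
have lt_is j : j \in s -> (i < j)%N.
  by move=> js; apply: (allP (order_path_min ltn_trans pis)); apply: map_f.
have is' : i \notin s by apply/negP=> /lt_is; rewrite ltnn.
apply/ffunP=> U; rewrite gen_wedgeE !ffunE set_cons.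
case: ifPn => iU; last first.
  by case: eqP iU => // ->; rewrite !inE eqxx.
have -> : (U == i |: [set:: s]) = (U :\ i == [set:: s]).
  apply/eqP/eqP=> [->|<-]; last by rewrite setD1K.
  by rewrite setU1K // inE.
case: eqP => [->|_]; last by rewrite mulr0.
rewrite big1 ?expr0 ?mul1r // => j; rewrite inE => /lt_is ij.
by rewrite ltnNge ltnW.
Qed.

End Laws.

(* Constant-coefficient forms on R^n_x (+) R^n_xi; the generators are
   dx_1, ..., dx_n, dxi_1, ..., dxi_n in this order. *)
Definition dform (R : realType) (n : nat) := ext R (n + n).

Definition dx {R : realType} {n : nat} (i : 'I_n) : dform R n :=
  gen (lshift n i).

Definition dxi {R : realType} {n : nat} (i : 'I_n) : dform R n :=
  gen (rshift n i).

Definition dxI {R : realType} {n : nat} (I : {set 'I_n}) : dform R n :=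
  \big[wedge/ext1]_(i <- enum I) dx i.

Definition dxiK {R : realType} {n : nat} (K : {set 'I_n}) : dform R n :=
  \big[wedge/ext1]_(k <- enum K) dxi k.

Definition has_bidegree {R : realType} {n : nat} (p q : nat) (u : dform R n) :
    Prop :=
  exists c : {set 'I_n} -> {set 'I_n} -> R,
    u = \sum_(I : {set 'I_n} | #|I| == p) \sum_(K : {set 'I_n} | #|K| == q)
          c I K *: wedge (dxI I) (dxiK K).

Definition delta_xi {R : realType} {n : nat} (i : 'I_n) :
    dform R n -> dform R n :=
  contract (rshift n i).

Definition opT {R : realType} {n : nat} (u : dform R n) : dform R n :=
  \sum_(i < n) wedge (dx i) (delta_xi i u).

(* A (1,0)-form alpha is represented by its coefficient vector a: form10 a is
   alpha itself and sharp a is alpha^#. *)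
Definition form10 {R : realType} {n : nat} (a : 'rV[R]_n) : dform R n :=
  \sum_(j < n) a 0 j *: dx j.

Definition sharp {R : realType} {n : nat} (a : 'rV[R]_n) : dform R n :=
  \sum_(j < n) a 0 j *: dxi j.

Definition elementary {R : realType} {n : nat} (p : nat) (w : dform R n) :
    Prop :=
  exists alpha : 'I_p -> 'rV[R]_n,
    w = \big[wedge/ext1]_(i < p) wedge (form10 (alpha i)) (sharp (alpha i)).

(* Main.v *)
(** Write a_i, b_i for the exterior multiplications by dx_i, dxi_i and a_i^*,
    b_i^* for the corresponding contractions; they satisfy the canonical
    anticommutation relations, and T = \sum_i a_i b_i^*.  The operators
    D_ij = b_j^* a_i^* + b_i^* a_j^* preserve ker T, and the Capelli-type
    identity
      \sum_ij a_i b_j D_ij = N_a N_b + N_b - (\sum_j b_j a_j^* ) T,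
    with N_a, N_b the degree operators, shows that Omega in ker T of bidegree
    (p, p) is recovered, up to the factor p (p + 1) != 0, from the D_ij Omega,
    which have bidegree (p - 1, p - 1).  As D_ij is symmetric in i and j, one
    may replace a_i b_j by (a_i b_j + a_j b_i) / 2, which is a combination of
    elementary (1,1)-forms by polarization; conclude by induction on p. *)
Require Import Defs.
From HB Require Import structures.
From mathcomp Require Import all_boot all_order all_algebra.
From mathcomp Require Import reals.

Set Implicit Arguments.
Unset Strict Implicit.
Unset Printing Implicit Defensive.

Import GRing.Theory Num.Theory.
Local Open Scope ring_scope.

(** * Linearity and anticommutation of wedge and contraction *)

Section ExteriorAlgebra.
Variables (R : realType) (m : nat).
Implicit Types (u v w : ext R m) (A S X : {set 'I_m}) (i j k : 'I_m).

Lemma wedge_is_linear u : linear (wedge u).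
Proof.
move=> c v w; apply/ffunP=> S; rewrite !ffunE scaler_sumr -big_split /=.
by apply: eq_bigr => A _; rewrite !ffunE mulrDr -scalerAr.
Qed.

HB.instance Definition _ u :=
  GRing.isLinear.Build R (ext R m) (ext R m) *:%R (wedge u) (wedge_is_linear u).

Lemma contract_is_linear k : linear (@contract R m k).
Proof.
move=> c v w; apply/ffunP=> S; rewrite !ffunE.
by case: ifP => _; rewrite ?scaler0 ?addr0 // mulrDr -scalerAr.
Qed.

HB.instance Definition _ k :=
  GRing.isLinear.Build R (ext R m) (ext R m) *:%R (@contract R m k)
    (contract_is_linear k).

Lemma wedgeDl u v w : wedge (u + v) w = wedge u w + wedge v w.
Proof.
apply/ffunP=> S; rewrite !ffunE -big_split /=.
by apply: eq_bigr => A _; rewrite ffunE mulrDr mulrDl.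
Qed.

Lemma wedgeNl u v : wedge (- u) v = - wedge u v.
Proof.
apply/ffunP=> S; rewrite !ffunE -sumrN.
by apply: eq_bigr => A _; rewrite ffunE mulrN mulNr.
Qed.

Lemma gen_wedge_anticomm i j u :
  wedge (gen i) (wedge (gen j) u) = - wedge (gen j) (wedge (gen i) u).
Proof. by rewrite !wedgeA gen_anticomm wedgeNl. Qed.

Lemma contract_anticomm i j u :
  contract i (contract j u) = - contract j (contract i u).
Proof.
apply/ffunP=> S; rewrite !ffunE !in_setU1.
have [->|nij] := eqVneq i j; first by rewrite ?eqxx /= mulr0 if_same oppr0.
rewrite /=.
case: (boolP (i \in S)) => iS; case: (boolP (j \in S)) => jS;
  rewrite ?mulr0 ?oppr0 //.
rewrite !big_setU1 //= !mulrA -!exprD -mulNr setUCA; congr (_ * _).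
(* The two exponents agree except for the terms [i < j] and [j < i], exactly one of which is 1. *)
rewrite addnCA [X in - (-1) ^+ X]addnCA [X in - (-1) ^+ (_ + X)]addnC.
rewrite ![_ ^+ (nat_of_bool _ + _)]exprD -mulNr; congr (_ * _).
by move: nij; rewrite -val_eqE /=; case: ltngtP => // _ _;
   rewrite ?expr0 ?expr1 ?opprK.
Qed.

Lemma gen_wedge_contract k i u :
  wedge (gen i) (contract k u) =
  (i == k)%:R *: u - contract k (wedge (gen i) u).
Proof. by rewrite contract_gen_wedge opprB addrC subrK. Qed.

(** * Partial degrees, counted in the generators of a set [X] *)

Definition homog X d u := forall S, u S != 0 -> #|S :&: X| = d.

Lemma homog0 X d : homog X d 0.
Proof. by move=> S; rewrite ffunE eqxx. Qed.

Lemma homogD X d u v : homog X d u -> homog X d v -> homog X d (u + v).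
Proof.
move=> hu hv S; rewrite ffunE; have [u0|/hu //] := eqVneq (u S) 0.
by rewrite u0 add0r => /hv.
Qed.

Lemma homogZ X d c u : homog X d u -> homog X d (c *: u).
Proof.
move=> hu S uS; apply: hu; apply: contraNneq uS => u0.
by rewrite ffunE u0 scaler0.
Qed.

Lemma homog_sum X d (I : Type) (r : seq I) (P : pred I) (F : I -> ext R m) :
  (forall x, P x -> homog X d (F x)) -> homog X d (\sum_(x <- r | P x) F x).
Proof.
by move=> hF; apply: big_ind => //; [exact: homog0 | move=> u v; exact: homogD].
Qed.

Lemma homog_blade X S : homog X #|S :&: X| (blade S).
Proof. by move=> U; rewrite ffunE; case: (U =P S) => [->|]; rewrite ?eqxx. Qed.

Lemma homog_wedge X d e u v :
  homog X d u -> homog X e v -> homog X (d + e) (wedge u v).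
Proof.
move=> hu hv S; apply: contra_neq_eq => nS; rewrite ffunE big1 // => A sAS.
have [->|/hu uA] := eqVneq (u A) 0; first by rewrite mulr0 mul0r.
have [->|/hv vA] := eqVneq (v (S :\: A)) 0; first by rewrite mulr0.
case/eqP: nS; rewrite -uA -vA -(cardsID A (S :&: X)) setIAC (setIidPr sAS).
by rewrite setIDAC.
Qed.

Lemma homog_prod X d (I : Type) (r : seq I) (F : I -> ext R m) :
  (forall x, homog X d (F x)) ->
  homog X (size r * d) (\big[wedge/ext1]_(x <- r) F x).
Proof.
move=> hF; elim: r => [|x r IHr].
  by rewrite big_nil mul0n -(cards0 'I_m) -(set0I X); exact: homog_blade.
by rewrite big_cons mulSn; exact: homog_wedge.
Qed.

(** The truncated subtraction is harmless: for [d = 0] and [k \in X] the contraction vanishes, and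
    zero is homogeneous of every degree. *)
Lemma homog_contract X d k u : homog X d u ->
  homog X (d - (k \in X)) (contract k u).
Proof.
move=> hu S; rewrite ffunE; case: ifPn => [_|kS]; first by rewrite eqxx.
rewrite mulf_eq0 negb_or => /andP[_ /hu <-]; rewrite setIUl.
have [kX|kX] := boolP (k \in X); last first.
  by rewrite subn0; congr #|pred_of_set _|; apply/setP=> x; rewrite !inE;
     case: eqP => //= ->; rewrite (negbTE kX) (negbTE kS).
have /setIidPl -> : [set k] \subset X by rewrite sub1set.
by rewrite cardsU1 inE (negbTE kS) /= addKn.
Qed.

(** Both signs count the elements of [S :\ i] below [i], so they cancel and a projector remains. *)
Lemma gen_wedge_contract_diag i u S :
  wedge (gen i) (contract i u) S = (i \in S)%:R * u S.
Proof.
rewrite gen_wedgeE; case: ifPn => iS; last by rewrite mul0r.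
by rewrite ffunE setD11 setD1K // mulrA -expr2 sqrr_sign.
Qed.

(** Each summand projects onto the blades containing [i], so the sum multiplies the coefficient at
    [S] by the cardinal of [S :&: X]. *)
Lemma euler_homog X d u : homog X d u ->
  \sum_(i in X) wedge (gen i) (contract i u) = d%:R *: u.
Proof.
move=> hu; apply/ffunP=> S; rewrite sum_ffunE ffunE.
under eq_bigr => i _ do rewrite gen_wedge_contract_diag.
rewrite -mulr_suml -natr_sum -big_mkcondr sum1dep_card /=.
have [->|uS] := eqVneq (u S) 0; first by rewrite mulr0 scaler0.
rewrite -(hu S uS); congr (_%:R * _); apply: eq_card => x.
by rewrite !inE andbC.
Qed.

End ExteriorAlgebra.

(** * Bidegree and Euler identities for forms in x and xi *)

Section Forms.
Variables (R : realType) (n : nat).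
Implicit Types (u v w : dform R n) (i j k : 'I_n) (a b : 'rV[R]_n).

Local Notation delta_x i := (contract (lshift n i)).

Definition xset : {set 'I_(n + n)} := [set lshift n i | i in 'I_n].
Definition xiset : {set 'I_(n + n)} := [set rshift n i | i in 'I_n].

Lemma lshift_xset i : lshift n i \in xset. Proof. exact: imset_f. Qed.

Lemma rshift_xiset i : rshift n i \in xiset. Proof. exact: imset_f. Qed.

Lemma rshift_xset i : (rshift n i \in xset) = false.
Proof. by apply/imsetP=> -[j _ /eqP]; rewrite eq_rlshift. Qed.

Lemma lshift_xiset i : (lshift n i \in xiset) = false.
Proof. by apply/imsetP=> -[j _ /eqP]; rewrite eq_lrshift. Qed.

Definition bihomog p q u := homog xset p u /\ homog xiset q u.

Lemma card1I (X : {set 'I_(n + n)}) (k : 'I_(n + n)) :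
  #|[set k] :&: X| = (k \in X).
Proof.
have [kX|kX] := boolP (k \in X).
  by rewrite (setIidPl _) ?cards1 ?sub1set.
by rewrite (disjoint_setI0 _) ?cards0 // disjoints1.
Qed.

Lemma bihomog_bidegree p q u : has_bidegree p q u -> bihomog p q u.
Proof.
(* The flag [t] tells whether the generators [f i] count towards the degree in [X], so one statement
   serves both [dxI] and [dxiK], for [xset] and [xiset] alike. *)
have hx (X : {set 'I_(n + n)}) (I : {set 'I_n}) (f : 'I_n -> 'I_(n + n))
      (t : bool) :
    (forall i, (f i \in X) = t) ->
    homog X (#|I| * t) (\big[wedge/ext1]_(i <- enum I) gen (f i) : dform R n).
  move=> hf; rewrite cardE; apply: homog_prod => i.
  by rewrite -(hf i) -card1I; exact: homog_blade.
case=> c ->; split; apply: homog_sum => I /eqP pI;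
  apply: homog_sum => K /eqP qK; apply: homogZ.
- have -> : p = (#|I| * true + #|K| * false)%N by rewrite muln1 muln0 addn0.
  apply: homog_wedge.
    by apply: (hx _ _ (@lshift n n) true); exact: lshift_xset.
  by apply: (hx _ _ (@rshift n n) false); exact: rshift_xset.
- have -> : q = (#|I| * false + #|K| * true)%N by rewrite muln1 muln0.
  apply: homog_wedge.
    by apply: (hx _ _ (@lshift n n) false); exact: lshift_xiset.
  by apply: (hx _ _ (@rshift n n) true); exact: rshift_xiset.
Qed.

Lemma bihomog_delta p q i j u : bihomog p q u ->
  bihomog p.-1 q.-1 (delta_xi j (delta_x i u)).
Proof.
case=> hx hxi; split.
  have /(homog_contract (k := rshift n j)) := homog_contract (k := lshift n i) hx.
  by rewrite lshift_xset rshift_xset subn0 subn1.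
have := homog_contract (k := rshift n j) (homog_contract (k := lshift n i) hxi).
by rewrite lshift_xiset rshift_xiset subn0 subn1.
Qed.

Lemma euler_x p u : homog xset p u ->
  \sum_i wedge (dx i) (delta_x i u) = p%:R *: u.
Proof.
move/euler_homog=> <-; rewrite big_imset //=.
by apply: in2W; exact: lshift_inj.
Qed.

Lemma euler_xi p u : homog xiset p u ->
  \sum_i wedge (dxi i) (delta_xi i u) = p%:R *: u.
Proof.
move/euler_homog=> <-; rewrite big_imset //=.
by apply: in2W; exact: rshift_inj.
Qed.

(** Every generator lies in [xset] or [xiset], so only the empty blade can occur. *)
Lemma bihomog00 u : bihomog 0 0 u -> u = u set0 *: ext1.
Proof.
case=> hx hxi; apply/ffunP=> S; rewrite !ffunE.
have [->|nS] := eqVneq S set0; first by rewrite [RHS]mulr1.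
rewrite [RHS]mulr0; apply/eqP; apply: contra_neqT nS => uS.
apply/setP=> x; rewrite inE; apply/negP=> xS.
move/cards0_eq: (hx S uS) => /setP/(_ x).
move/cards0_eq: (hxi S uS) => /setP/(_ x).
by rewrite !inE xS; case: (split_ordP x) => i ->;
   rewrite ?lshift_xset ?rshift_xiset.
Qed.

(** * The operators D_ij and the Capelli-type identity *)

Definition sym_delta i j u :=
  delta_xi j (delta_x i u) + delta_xi i (delta_x j u).

Lemma sym_deltaC i j u : sym_delta i j u = sym_delta j i u.
Proof. by rewrite /sym_delta addrC. Qed.

(** Moving both contractions to the left past each a_k b_k^* rebuilds T, which kills [u]; only a_i
    fails to anticommute with a_i^*, whence the remainder. It is antisymmetric in i and j, so it
    cancels in [sym_delta]. *)
Lemma opT_delta i j u : opT u = 0 ->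
  opT (delta_xi j (delta_x i u)) = - delta_xi j (delta_xi i u).
Proof.
move=> Tu; rewrite /opT.
have E k : wedge (dx k) (delta_xi k (delta_xi j (delta_x i u))) =
    delta_xi j (delta_x i (wedge (dx k) (delta_xi k u)))
    - (k == i)%:R *: delta_xi j (delta_xi k u).
  rewrite /delta_xi /dx (contract_anticomm (rshift n k)).
  rewrite (contract_anticomm (rshift n k) (lshift n i)) !raddfN opprK /=.
  rewrite gen_wedge_contract eq_lrshift scale0r sub0r gen_wedge_contract.
  by rewrite eq_lshift raddfB /= linearZ opprB.
under eq_bigr do rewrite E.
rewrite sumrB -2!raddf_sum -/(opT u) Tu !raddf0 sub0r; congr (- _).
rewrite (bigD1 i) //= eqxx scale1r big1 ?addr0 // => k /negbTE ->.
exact: scale0r.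
Qed.

Lemma opT_sym_delta i j u : opT u = 0 -> opT (sym_delta i j u) = 0.
Proof.
move=> Tu; have TD v w : opT (v + w) = opT v + opT w.
  rewrite /opT -big_split; apply: eq_bigr => k _.
  by rewrite /delta_xi /= !raddfD.
by rewrite TD !opT_delta // /delta_xi contract_anticomm opprK subrr.
Qed.

(** Contraction by [lshift n i] keeps the xi-degree, so the inner sum is an Euler identity in xi and
    the outer one in x. *)
Lemma sum_wedge_delta p q u : bihomog p q u ->
  \sum_i \sum_j wedge (dx i) (wedge (dxi j) (delta_xi j (delta_x i u))) =
  (p * q)%:R *: u.
Proof.
case=> hx hxi; under eq_bigr => i _.
  rewrite -raddf_sum (@euler_xi q) /=; last first.
    by have := homog_contract (k := lshift n i) hxi; rewrite lshift_xiset subn0.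
  rewrite linearZ; over.
by rewrite -scaler_sumr (euler_x hx) scalerA mulrC natrM.
Qed.

Lemma sum_wedge_delta_swap q u : homog xiset q u -> opT u = 0 ->
  \sum_i \sum_j wedge (dx i) (wedge (dxi j) (delta_xi i (delta_x j u))) =
  q%:R *: u.
Proof.
move=> hxi Tu.
(* Bring a_i next to b_i^*, so that the sum over i, made the inner one below, produces T; the
   diagonal terms form the Euler sum in xi. *)
have E i j : wedge (dx i) (wedge (dxi j) (delta_xi i (delta_x j u))) =
    (i == j)%:R *: wedge (dxi j) (delta_xi i u)
    - wedge (dxi j) (delta_x j (wedge (dx i) (delta_xi i u))).
  rewrite /delta_xi gen_wedge_anticomm contract_anticomm !raddfN opprK /=.
  by rewrite gen_wedge_contract eq_lshift raddfB /= linearZ.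
rewrite exchange_big -(euler_xi hxi); apply: eq_bigr => j _.
under eq_bigr do rewrite E.
rewrite sumrB -2!raddf_sum -/(opT u) Tu !raddf0 addr0.
rewrite (bigD1 j) //= eqxx scale1r big1 ?addr0 // => i /negbTE ->.
exact: scale0r.
Qed.

Lemma capelli_identity p u : bihomog p p u -> opT u = 0 ->
  \sum_i \sum_j wedge (dx i) (wedge (dxi j) (sym_delta i j u)) =
  (p * p.+1)%:R *: u.
Proof.
move=> hu Tu; rewrite mulnS natrD scalerDl.
rewrite -(sum_wedge_delta_swap (proj2 hu) Tu) -(sum_wedge_delta hu) addrC.
rewrite -big_split; apply: eq_bigr => i _.
by rewrite -big_split; apply: eq_bigr => j _; rewrite /sym_delta !raddfD.
Qed.

(** * Polarization and the span of elementary forms *)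

Definition elem11 a u := wedge (wedge (form10 a) (sharp a)) u.

Lemma form10D a b : form10 (a + b) = form10 a + form10 b.
Proof.
by rewrite /form10 -big_split; apply: eq_bigr => j _; rewrite mxE scalerDl.
Qed.

Lemma sharpD a b : sharp (a + b) = sharp a + sharp b.
Proof.
by rewrite /sharp -big_split; apply: eq_bigr => j _; rewrite mxE scalerDl.
Qed.

Lemma form10_delta i : form10 (delta_mx 0 i) = dx i :> dform R n.
Proof.
rewrite /form10 (bigD1 i) //= mxE !eqxx scale1r big1 ?addr0 // => j /negbTE ji.
by rewrite mxE ji andbF scale0r.
Qed.

Lemma sharp_delta i : sharp (delta_mx 0 i) = dxi i :> dform R n.
Proof.
rewrite /sharp (bigD1 i) //= mxE !eqxx scale1r big1 ?addr0 // => j /negbTE ji.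
by rewrite mxE ji andbF scale0r.
Qed.

(** The form [a] wedge its sharp is quadratic in [a]; the left side collects its cross terms at
    [e i + e j]. *)
Lemma elem11_polarization i j u (e := fun k => delta_mx 0 k : 'rV[R]_n) :
  wedge (dx i) (wedge (dxi j) u) + wedge (dx j) (wedge (dxi i) u) =
  elem11 (e i + e j) u - elem11 (e i) u - elem11 (e j) u.
Proof.
rewrite /elem11 form10D sharpD !form10_delta !sharp_delta -!wedgeA.
rewrite !wedgeDl !raddfD /=.
by rewrite [X in _ = X - _]addrAC [X in _ = X + _ - _]addrAC
  subrr add0r addrA addrK.
Qed.

Definition elementary_span p u :=
  exists (N : nat) (c : 'I_N -> R) (w : 'I_N -> dform R n),
    (forall j : 'I_N, elementary p (w j)) /\ u = \sum_(j < N) c j *: w j.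

Lemma elementary_span0 p : elementary_span p 0.
Proof.
exists 0, (fun=> 0), (fun=> 0); split; first by case.
by rewrite big_ord0.
Qed.

Lemma elementary_spanD p u v :
  elementary_span p u -> elementary_span p v -> elementary_span p (u + v).
Proof.
case=> N [c [w [hw ->]]] [N' [c' [w' [hw' ->]]]].
exists (N + N')%N.
exists (fun k : 'I_(N + N') => match split k with
  inl x => c x | inr x => c' x end).
exists (fun k : 'I_(N + N') => match split k with
  inl x => w x | inr x => w' x end).
split=> [k|]; first by case: (split k).
rewrite big_split_ord; congr (_ + _); apply: eq_bigr => x _.
  by rewrite (unsplitK (inl x)).
by rewrite (unsplitK (inr x)).
Qed.

Lemma elementary_spanZ p (t : R) u :
  elementary_span p u -> elementary_span p (t *: u).
Proof.
case=> N [c [w [hw ->]]]; exists N, (fun k : 'I_N => t * c k), w; split=> //.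
by rewrite scaler_sumr; apply: eq_bigr => k _; rewrite scalerA.
Qed.

Lemma elementary_span_sum p (I : Type) (r : seq I) (P : pred I)
    (F : I -> dform R n) :
  (forall x, P x -> elementary_span p (F x)) ->
  elementary_span p (\sum_(x <- r | P x) F x).
Proof.
move=> hF; apply: big_ind => //; first exact: elementary_span0.
exact: elementary_spanD.
Qed.

Lemma elementary_span_elem11 p a u :
  elementary_span p u -> elementary_span p.+1 (elem11 a u).
Proof.
case=> N [c [w [hw ->]]]; exists N, c, (fun k : 'I_N => elem11 a (w k)).
split=> [k|].
  have [alpha ->] := hw k.
  exists (fun k : 'I_p.+1 => if unlift ord0 k is Some k' then alpha k' else a).
  rewrite big_ord_recl unlift_none; congr wedge.
  by apply: eq_bigr => k' _; rewrite liftK.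
by rewrite /elem11 raddf_sum; apply: eq_bigr => x _; exact: linearZ.
Qed.

Lemma ker_opT_elementary_span p u :
  bihomog p p u -> opT u = 0 -> elementary_span p u.
Proof.
elim: p u => [|p IHp] u hu Tu.
  (* In bidegree (0, 0) the form is a constant times [ext1], the empty product, which is
     elementary. *)
  exists 1, (fun=> u set0), (fun=> ext1); split=> [k|]; last first.
    by rewrite big_ord1; exact: bihomog00.
  by exists (fun=> 0); rewrite big_ord0.
have hD i j : elementary_span p (sym_delta i j u).
  apply: IHp (opT_sym_delta _ _ Tu).
  have [hij hij'] := bihomog_delta i j hu.
  have [hji hji'] := bihomog_delta j i hu.
  by split; apply: homogD.
(* The Capelli factor is doubled: two copies of the identity are added instead of halving a
   symmetrized one. *)
have c0 : (p.+1 * p.+2)%:R + (p.+1 * p.+2)%:R != 0 :> R.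
  by rewrite -natrD pnatr_eq0.
rewrite -[u]scale1r -(mulVf c0) -scalerA; apply: elementary_spanZ.
(* Exchanging the sums in the second copy pairs a_i b_j D_ij with a_j b_i D_ji; as D_ji = D_ij,
   polarization applies to each pair. *)
rewrite scalerDl -(capelli_identity hu Tu) {2}exchange_big -big_split.
apply: elementary_span_sum => i _; rewrite -big_split.
apply: elementary_span_sum => j _ /=; rewrite (sym_deltaC j i).
rewrite elem11_polarization -!scaleN1r.
by do 2?[apply: elementary_spanD]; do ?apply: elementary_spanZ;
   exact: elementary_span_elem11.
Qed.

End Forms.

Theorem theorem18p1 (R : realType) (n p : nat) (Omega : dform R n)
    (hbideg : has_bidegree p p Omega) (hT : opT Omega = 0) :
  exists (N : nat) (c : 'I_N -> R) (w : 'I_N -> dform R n),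
    (forall j : 'I_N, elementary p (w j)) /\
    Omega = \sum_(j < N) c j *: w j.
Proof. exact: ker_opT_elementary_span (bihomog_bidegree hbideg) hT. Qed.
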